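(* Let $X\subset \mathbb{P}^N$ be a hypersurface of degree $d\ge 2$ over a field, and let $\mathcal{L}=(L_1,\ldots,L_s)$ be a (nonempty, finite) collection of linear subspaces contained in $X$ such that $\operatorname{codim}_{\mathbb{P}^N}L_i\le r$ for all $i$, where $r\ge 2$. Let $$L_0:=\langle L \mid L\in \mathcal{L}^{(d-1)}\rangle$$ be the linear span of all members of the collection $\mathcal{L}^{(d-1)}$. Then $L_0\subset X$ and $$\operatorname{codim}_{\mathbb{P}^N} L_0 \le r^{2^{d-1}}.$$
   Context: For linear subspaces $L_1,\ldots,L_s\subset\mathbb{P}^N$, $\langle L_1,\ldots,L_s\rangle\subset\mathbb{P}^N$ denotes their linear span. Linear subspaces of $\mathbb{P}^N=\mathbb{P}V$ correspond to vector subspaces $U\subset V$ (the empty one corresponding to $U=0$), with $\operatorname{codim}_{\mathbb{P}V}\mathbb{P}U=\dim V-\dim U$; spans and intersections correspond to sums and intersections of vector subspaces. For a hypersurface $X=(f=0)$, $\mathbb{P}U\subset X$ means that $f$ lies in the ideal generated by the linear forms vanishing on $U$. For a collection $\mathcal{L}=\{L_1,\ldots,L_s\}$ of linear subspaces of $\mathbb{P}^N$, a new collection $\mathcal{L}^{(1)}$ is defined as follows. Let $L=\langle L_1,\ldots,L_s\rangle$. For each minimal (with respect to inclusion) subset $J\subset [1,s]$ such that $\langle L_j \mid j\in J\rangle=L$, set $L_J:=\bigcap_{j\in J}L_j$. Then $\mathcal{L}^{(1)}$ is the collection of all such subspaces $L_J$. For $i\ge 1$, $\mathcal{L}^{(i)}$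 denotes the collection obtained from $\mathcal{L}$ by iterating this construction $i$ times. *)

(* Defs.v *)
From HB Require Import structures.
From mathcomp Require Import all_boot all_order all_algebra.
From mathcomp Require Import mpoly.

Set Implicit Arguments.
Unset Strict Implicit.
Unset Printing Implicit Defensive.

Import GRing.Theory.
Local Open Scope ring_scope.

Section Collections.

Variables (k : fieldType) (V : vectType k).
Implicit Types (U : {vspace V}) (Ls : seq {vspace V}).

Definition codimv U : nat := (\dim (fullv : {vspace V}) - \dim U)%N.

Definition lspan Ls : {vspace V} := (\sum_(U <- Ls) U)%VS.

Definition lspan_on Ls (J : {set 'I_(size Ls)}) : {vspace V} :=
  (\sum_(j in J) tnth (in_tuple Ls) j)%VS.

Definition lcap_on Ls (J : {set 'I_(size Ls)}) : {vspace V} :=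
  (\bigcap_(j in J) tnth (in_tuple Ls) j)%VS.

(* J ranges over nonempty index sets. This matters only when every member of
   Ls is 0: then the empty family already spans, and its intersection would be
   all of V; requiring J nonempty gives the members of Ls, i.e. 0, instead. *)
Definition spanning Ls : pred {set 'I_(size Ls)} :=
  fun J => (J != set0) && (lspan_on J == lspan Ls).

Definition derived Ls : seq {vspace V} :=
  [seq lcap_on J | J in [set J : {set 'I_(size Ls)} | minset (spanning (Ls := Ls)) J]].

Definition derivedn (i : nat) Ls : seq {vspace V} := iter i derived Ls.

End Collections.

Section Hypersurfaces.

Variables (k : fieldType) (n : nat).
Implicit Types (f l : {mpoly k[n]}) (U : {vspace 'rV[k]_n}).

Definition linear_form_vanishing_on U l : Prop :=
  l \is 1.-homog /\ forall u, u \in U -> l.@[fun i => u ord0 i] = 0.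

Definition in_ideal_generated_by (S : {mpoly k[n]} -> Prop) f : Prop :=
  exists (m : nat) (g l : 'I_m -> {mpoly k[n]}),
    (forall i, S (l i)) /\ f = \sum_(i < m) g i * l i.

(* P U is contained in the hypersurface f = 0 as a subscheme; over a finite
   field this is stronger than the vanishing of f at the points of U. *)
Definition contained_in_hypersurface U f : Prop :=
  in_ideal_generated_by (linear_form_vanishing_on U) f.

End Hypersurfaces.

(* Main.v *)
(* Write U_A for the A-points of a subspace U, where A is a polynomial ring over
   k, and let (D_(b,y) g)(x) be the coefficient of t^b in g(x + t y). If g has
   coefficients in A and vanishes on L_A for every L in Ls, then
   (D_(b,y) g)(x) = 0 whenever x is in M_A for some M in Ls^(b) and y is in the
   A-points of the span of Ls^(b-1). Indeed, if M is the intersection of a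
   spanning subfamily (P_j), write y as a sum of y_j in P_j and expand
   D_(b,y) g = \sum D_(b - i,z) (D_(i,y_j) g) with y = y_j + z: the terms with
   0 < i < b vanish by induction applied to D_(i,y_j) g and Ls^(i), and the pure
   terms D_(b,y_j) g vanish at x since g is zero on the line x + t y_j inside P_j.
   Taking b = d and x = 0 gives f(y) = 0. Hasse derivatives replace iterated
   partial derivatives in order to cover positive characteristic.

   For the codimension, a minimal spanning J has at most r + 1 elements; when it
   has exactly r + 1, each L_j has codimension at most 1 in L_j0 + L_j. *)

Require Import Defs.
From HB Require Import structures.
From mathcomp Require Import all_boot all_order all_algebra.
From mathcomp Require Import mpoly zify.

Set Implicit Arguments.
Unset Strict Implicit.
Unset Printing Implicit Defensive.

Import GRing.Theory.
Local Open Scope ring_scope.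

(** Reduces the Taylor identities below to a check on constants and variables. *)
Lemma mpoly_rmorph_ext (n : nat) (R : comNzRingType) (S : comNzRingType)
    (phi psi : {rmorphism {mpoly R[n]} -> S}) :
  (forall c, phi c%:MP = psi c%:MP) -> (forall i, phi 'X_i = psi 'X_i) ->
  phi =1 psi.
Proof.
move=> eqC eqX; elim/mpolyind=> [|c m p _ _ IHp]; first by rewrite !rmorph0.
rewrite !rmorphD /= IHp -!mul_mpolyC !rmorphM /= eqC; congr (_ * _ + _).
rewrite mpolyXE_id !rmorph_prod; apply: eq_bigr => i _.
by rewrite !rmorphXn /= eqX.
Qed.

(** * Taylor expansion and Hasse derivatives *)

Section HasseDerivative.

Variables (n : nat) (A : comNzRingType).
Implicit Types (g : {mpoly A[n]}) (x y z : 'rV[A]_n).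

(** The expansion of g(x + t y), where the outer ['X] plays the role of t. *)
Definition taylor y : {mpoly A[n]} -> {poly {mpoly A[n]}} :=
  mmap (polyC \o @mpolyC n A) (fun i => ('X_i)%:P + (y 0 i)%:MP *: 'X).

HB.instance Definition _ y := GRing.RMorphism.on (taylor y).

Definition hasse b y g : {mpoly A[n]} := (taylor y g)`_b.

Lemma taylorC y c : taylor y c%:MP = c%:MP%:P.
Proof. exact: mmapC. Qed.

Lemma taylorX y i : taylor y 'X_i = ('X_i)%:P + (y 0 i)%:MP *: 'X.
Proof. by rewrite /taylor mmapX mmap1U. Qed.

(** Expanding the coefficients along [z] brings in a second parameter; evaluating the outer one at
    ['X] makes the two equal. *)
Lemma taylorD y z g :
  taylor (y + z) g = (map_poly (taylor z) (taylor y g)).['X].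
Proof.
pose psi := horner_eval 'X \o map_poly (taylor z) \o taylor y.
suff: taylor (y + z) =1 psi by apply.
apply: (@mpoly_rmorph_ext n A _ (taylor (y + z)) psi) => [c|i].
  by rewrite /psi /= !taylorC map_polyC /= /horner_eval hornerC taylorC.
rewrite /psi /= !taylorX rmorphD /= map_polyC /= map_polyZ map_polyX /=.
rewrite /horner_eval !hornerE taylorC taylorX mxE mpolyCD scalerDl.
by rewrite -!mul_polyC addrAC addrA.
Qed.

Lemma hasseD b y z g :
  hasse b (y + z) g = \sum_(i < b.+1) hasse (b - i) z (hasse i y g).
Proof.
rewrite /hasse taylorD; set p := taylor y g.
(* A common range for both sums: indices i > b contribute nothing to the coefficient of degree b,
   and indices beyond [size p] give zero coefficients. *)
pose m := maxn (size p) b.+1.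
rewrite (@horner_coef_wide _ m); last first.
  by rewrite (leq_trans (size_poly _ _)) ?leq_maxl.
rewrite coef_sum.
rewrite (big_ord_widen m (fun i => (taylor z p`_i)`_(b - i))) ?leq_maxr //.
rewrite [RHS]big_mkcond /=; apply: eq_bigr => i _.
rewrite coef_map_id0 ?rmorph0 // coefMXn [(i < b.+1)%N]ltnS.
by case: ltnP.
Qed.

Lemma hasse0 y g : hasse 0 y g = g.
Proof.
suff: coefp 0 \o taylor y =1 idfun by apply.
apply: (@mpoly_rmorph_ext n A _ (coefp 0 \o taylor y) idfun) => [c|i] /=.
  by rewrite taylorC coefC.
by rewrite taylorX coefD coefC coefZ coefX mulr0 addr0.
Qed.

Lemma horner_taylor x y a g :
  (map_poly (meval (x 0)) (taylor y g)).[a] = g.@[(x + a *: y) 0].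
Proof.
pose phi := horner_eval a \o map_poly (meval (x 0)) \o taylor y.
suff: phi =1 meval ((x + a *: y) 0) by apply.
apply: (@mpoly_rmorph_ext n A _ phi (meval ((x + a *: y) 0))) => [c|i].
  by rewrite /phi /= taylorC map_polyC /= /horner_eval hornerC !mevalC.
rewrite /phi /= taylorX rmorphD /= map_polyC /= map_polyZ map_polyX /=.
by rewrite /horner_eval !hornerE mevalC !mevalXU !mxE mulrC.
Qed.

Lemma hasse_at0 b g : hasse b 0 g = if b == 0 then g else 0.
Proof.
suff E: taylor 0 g = g%:P by rewrite /hasse E coefC.
suff: taylor 0 =1 (@polyC _) by apply.
apply: (@mpoly_rmorph_ext n A _ (taylor 0) (@polyC _)) => [c|i] /=.
  by rewrite taylorC.
by rewrite taylorX mxE mpolyC0 scale0r addr0.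
Qed.

End HasseDerivative.

Lemma poly_eq0_infinite (A : idomainType) (e : nat -> A) (p : {poly A}) :
  injective e -> (forall a, p.[a] = 0) -> p = 0.
Proof.
move=> inj_e p0; apply/eqP; apply: contraT => nz_p.
have := @max_poly_roots _ p (mkseq e (size p)) nz_p.
rewrite size_mkseq ltnn; apply.
  by apply/allP => a _; apply/rootP.
exact: mkseq_uniq.
Qed.

(** * Spans and derived collections *)

Section Derived.

Variables (k : fieldType) (V : vectType k).
Implicit Types (U W : {vspace V}) (Ls : seq {vspace V}).

Lemma sub_lspan Ls U : U \in Ls -> (U <= lspan Ls)%VS.
Proof.
elim: Ls => // W Ls IHLs; rewrite in_cons /lspan big_cons => /predU1P[->|].
  exact: addvSl.
by move=> /IHLs; move/subv_trans; apply; exact: addvSr.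
Qed.

Lemma lspan_subP Ls W : (forall U, U \in Ls -> U <= W)%VS -> (lspan Ls <= W)%VS.
Proof.
rewrite /lspan => sLW; rewrite big_seq_cond.
by elim/big_rec: _ => [|U S /andP[LU _] sSW]; rewrite ?sub0v // subv_add sLW.
Qed.

Lemma derivedP Ls M :
  reflect (exists2 J, minset (spanning (Ls := Ls)) J & M = lcap_on J)
          (M \in derived Ls).
Proof.
rewrite /derived; apply: (iffP imageP) => -[J JP ->].
  by exists J => //; move: JP; rewrite inE.
by exists J => //; rewrite inE.
Qed.

Lemma derived_sub Ls M :
  M \in derived Ls -> exists2 U, U \in Ls & (M <= U)%VS.
Proof.
move=> /derivedP[J /minsetP[/andP[/set0Pn[j Jj] _] _] ->].
by exists (tnth (in_tuple Ls) j); [exact: mem_tnth | by apply: (bigcapv_inf j)].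
Qed.

Lemma derivedn_sub i Ls M :
  M \in derivedn i Ls -> exists2 U, U \in Ls & (M <= U)%VS.
Proof.
elim: i M => [|i IHi] M; first by exists M.
by move=> /derived_sub[W /IHi[U LU sWU] sMW]; exists U; rewrite ?(subv_trans sMW).
Qed.

Lemma derivednD i j Ls : derivedn (i + j) Ls = derivedn i (derivedn j Ls).
Proof. exact: iterD. Qed.

Lemma lspan_derivedn_anti i j Ls :
  (i <= j)%N -> (lspan (derivedn j Ls) <= lspan (derivedn i Ls))%VS.
Proof.
move=> /subnK<-; rewrite derivednD; apply: lspan_subP => M /derivedn_sub[U LU].
by move/subv_trans; apply; exact: sub_lspan.
Qed.

Lemma spanning_setT Ls : Ls != [::] -> spanning [set: 'I_(size Ls)].
Proof.
move=> Ls0; apply/andP; split.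
  by apply/set0Pn; case: Ls Ls0 => // U Ls _; exists ord0.
rewrite /lspan_on /lspan; apply/eqP; rewrite [RHS]big_tnth.
by apply: eq_bigl => i; rewrite inE.
Qed.

Lemma derived_neq0 Ls : Ls != [::] -> derived Ls != [::].
Proof.
move=> /spanning_setT/minset_exists[J minJ _].
have: lcap_on J \in derived Ls by apply/derivedP; exists J.
by case: (derived Ls).
Qed.

Lemma derivedn_neq0 i Ls : Ls != [::] -> derivedn i Ls != [::].
Proof. by move=> Ls0; elim: i => // i; exact: derived_neq0. Qed.

End Derived.

(** * Points of subspaces over a polynomial ring *)

Section ScalarExtension.

Variables (k : fieldType) (n q : nat).
Local Notation A := {mpoly k[q]}.
Implicit Types (U W : {vspace 'rV[k]_n}) (x y : 'rV[A]_n).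

Definition coefv m x : 'rV[k]_n := map_mx (mcoeff m) x.

(* The A-points of U: since A is free over k on the monomials, U tensor A consists
   of the vectors all of whose coefficients lie in U. *)
Definition ext_in U x : Prop := forall m, coefv m x \in U.

Lemma coefvP x y : (forall m, coefv m x = coefv m y) -> x = y.
Proof.
move=> eqxy; apply/matrixP=> i j; apply/mpolyP => m.
by move: (eqxy m) => /matrixP/(_ i j); rewrite !mxE.
Qed.

Lemma coefvD m x y : coefv m (x + y) = coefv m x + coefv m y.
Proof. exact: raddfD. Qed.

Lemma ext_in0 U : ext_in U 0.
Proof. by move=> m; rewrite /coefv raddf0 mem0v. Qed.

Lemma ext_inD U x y : ext_in U x -> ext_in U y -> ext_in U (x + y).
Proof. by move=> Ux Uy m; rewrite coefvD memvD. Qed.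

Lemma ext_inZ U a x : ext_in U x -> ext_in U (a *: x).
Proof.
move=> Ux m.
suff ->: coefv m (a *: x) = \sum_(l : 'X_{1..q < (mdeg m).+1, (mdeg m).+1} |
    m == (l.1 + l.2)%MM) a@_l.1 *: coefv l.2 x.
  by apply: memv_suml => l _; exact: memvZ.
apply/rowP=> i; rewrite !mxE summxE mcoeffM.
by apply: eq_bigr => l _; rewrite !mxE.
Qed.

Lemma ext_inS U W x : (U <= W)%VS -> ext_in U x -> ext_in W x.
Proof. by move=> /subvP sUW Ux m; exact: sUW. Qed.

Definition ext_lfun (phi : 'End('rV[k]_n)) x : 'rV[A]_n :=
  x *m map_mx (@mpolyC q k) (lin1_mx phi).

Lemma coefv_ext_lfun phi m x : coefv m (ext_lfun phi x) = phi (coefv m x).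
Proof.
rewrite -mul_rV_lin1; apply/rowP=> i; rewrite !mxE raddf_sum.
by apply: eq_bigr => j _; rewrite !mxE /= mulrC mcoeffCM mulrC.
Qed.

(** The [k]-linear projections [sumv_pi] of the sum onto its summands extend to [A], acting on each
    coefficient vector. *)
Lemma ext_in_sum (I : finType) (P : {pred I}) (Us : I -> {vspace 'rV[k]_n}) x :
  ext_in (\sum_(j in P) Us j)%VS x ->
  exists2 y : I -> 'rV[A]_n,
    forall j, ext_in (Us j) (y j) & x = \sum_(j in P) y j.
Proof.
move=> Ux; pose S := (\sum_(j in P) Us j)%VS.
exists (fun j => ext_lfun (sumv_pi S j) x) => [j m|].
  by rewrite coefv_ext_lfun memv_sum_pi.
apply: coefvP => m; rewrite -{1}(sumv_pi_sum (erefl S) (Ux m)).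
rewrite (big_morph (coefv m) (coefvD m) (raddf0 _)).
by apply: eq_bigr => j _; rewrite -coefv_ext_lfun.
Qed.

Definition mpoly_lift (f : {mpoly k[n]}) : {mpoly A[n]} :=
  map_mpoly (@mpolyC q k) f.

HB.instance Definition _ :=
  GRing.RMorphism.copy mpoly_lift (map_mpoly (@mpolyC q k)).

Lemma mpoly_lift_linear_form (c : 'I_n -> k) :
  mpoly_lift (\sum_i c i *: 'X_i) = \sum_i (c i)%:MP *: 'X_i.
Proof.
rewrite (raddf_sum mpoly_lift); apply: eq_bigr => i _.
by rewrite /= /mpoly_lift map_mpolyZ map_mpolyX.
Qed.

(** Points over [A] are tested because over a finite field the [k]-points do not detect membership
    in the ideal of [U]. *)
Definition vanishes_on U (g : {mpoly A[n]}) : Prop :=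
  forall x, ext_in U x -> g.@[x 0] = 0.

Lemma dhomog1_sum (l : {mpoly k[n]}) :
  l \is 1.-homog -> l = \sum_(i < n) l@_U_(i) *: 'X_i.
Proof.
move=> homl; apply/mpolyP => m; rewrite raddf_sum /=.
under eq_bigr do rewrite mcoeffZ mcoeffX.
have [/eqP/mdeg1P[j /eqP ->]|m1] := eqVneq (mdeg m) 1%N.
  rewrite (bigD1 j) //= eqxx mulr1 big1 ?addr0 // => i ij.
  rewrite (_ : U_(i)%MM == _ = false) ?mulr0 //.
  apply: contra_neqF ij => /eqP/(congr1 (fun m : 'X_{1..n} => m i)).
  by rewrite !mnm1E eqxx eq_sym; case: eqP.
rewrite (dhomog_nemf_coeff homl m1) big1 // => i _.
rewrite (_ : U_(i)%MM == _ = false) ?mulr0 //.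
by apply: contra_neqF m1 => /eqP <-; rewrite mdeg1.
Qed.

(** A linear form over [k] acts coefficientwise on an [A]-point, so it kills [x] once it kills every
    [coefv e x]. *)
Lemma contained_vanishes_on U f :
  contained_in_hypersurface U f -> vanishes_on U (mpoly_lift f).
Proof.
move=> [m [g [l [Ul ->]]]] x Ux.
rewrite (raddf_sum mpoly_lift) (raddf_sum (meval _)) big1 //= => i _.
rewrite (rmorphM mpoly_lift) /= mevalM [X in _ * X](_ : _ = 0) ?mulr0 //.
have [/dhomog1_sum defl l0] := Ul i.
apply/mpolyP => e; rewrite mcoeff0 -[RHS](l0 (coefv e x)) //.
rewrite [in LHS]defl [in RHS]defl mpoly_lift_linear_form !(raddf_sum (meval _)) /=.
rewrite (raddf_sum (mcoeff e)); apply: eq_bigr => j _.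
by rewrite /= !mevalZ !mevalXU mcoeffCM mxE.
Qed.

End ScalarExtension.

(** * The codimension bound *)

Section Codim.

Variables (k : fieldType) (V : vectType k).
Implicit Types (U W : {vspace V}) (Ls : seq {vspace V}).

Lemma codimv_le U r : (codimv U <= r)%N = (\dim {:V} <= \dim U + r)%N.
Proof. by rewrite /codimv leq_subLR. Qed.

Lemma dimv_bigcap_lower (I : finType) (J : {set I}) (W : I -> {vspace V}) U c :
  (forall j, j \in J -> \dim U <= \dim (U :&: W j) + c)%N ->
  (\dim U <= \dim (U :&: \bigcap_(j in J) W j) + #|J| * c)%N.
Proof.
move=> capW; rewrite -big_enum cardE.
have {capW} : forall j, j \in enum J -> (\dim U <= \dim (U :&: W j) + c)%N.
  by move=> j; rewrite mem_enum; exact: capW.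
elim: (enum J) => [|j s IHs] capW; first by rewrite big_nil capvf leq_addr.
have {}IHs : (\dim U <= \dim (U :&: \bigcap_(i <- s) W i) + size s * c)%N.
  by apply: IHs => i si; apply: capW; rewrite in_cons si orbT.
have {capW} := capW j (mem_head j s); rewrite big_cons /= mulSn.
set B := (\bigcap_(i <- s) W i)%VS in IHs *.
have sumle : (\dim ((U :&: W j) + (U :&: B)) <= \dim U)%N.
  by apply: dimvS; rewrite subv_add !capvSl.
have := dimv_sum_cap (U :&: W j) (U :&: B).
have -> : ((U :&: W j) :&: (U :&: B) = U :&: (W j :&: B))%VS.
  by rewrite capvA [(_ :&: U)%VS]capvC capvA capvv -capvA.
lia.
Qed.

Section MinimalFamily.

Variables (Ls : seq {vspace V}) (J : {set 'I_(size Ls)}).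
Hypothesis minJ : minset (spanning (Ls := Ls)) J.

(** Enlarge [K] to [J] one index at a time. Each new index j raises the dimension, since otherwise
    [J :\ j] would still span, against minimality; [K] being nonempty keeps [J :\ j] nonempty. *)
Lemma dim_lspan_on_min (K : {set 'I_(size Ls)}) :
  K != set0 -> K \subset J ->
  (\dim (lspan_on K) + (#|J| - #|K|) <= \dim (lspan Ls))%N.
Proof.
have /minsetP[/andP[_ /eqP spanJ] Jmin] := minJ.
move: {2}(#|J| - #|K|)%N (leqnn (#|J| - #|K|)) => m.
elim: m K => [|m IHm] K leKm K0 sKJ.
  rewrite (_ : _ - _ = 0)%N ?addn0; last by apply/eqP; rewrite -leqn0.
  by rewrite -spanJ dimvS // /lspan_on; apply/subv_sumP => j Kj;
    apply: (sumv_sup j) => //; apply: (subsetP sKJ).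
have [eqKJ|] := eqVneq K J; first by rewrite eqKJ subnn addn0 spanJ.
rewrite eqEsubset sKJ /= => /subsetPn[j Jj Kj].
have sjK : j |: K \subset J by rewrite subUset sub1set Jj.
have cardjK : #|j |: K| = #|K|.+1 by rewrite cardsU1 Kj.
have ltKJ : (#|K| < #|J|)%N by rewrite -cardjK subset_leq_card.
have jK0 : j |: K != set0 by apply/set0Pn; exists j; rewrite setU11.
have := IHm (j |: K); rewrite cardjK => /(_ _ jK0 sjK) IHK.
have {IHK} : (\dim (lspan_on (j |: K)) + (#|J| - #|K|.+1) <= \dim (lspan Ls))%N.
  by apply: IHK; lia.
suff ltdim : (\dim (lspan_on K) < \dim (lspan_on (j |: K)))%N.
  by apply: leq_trans; rewrite -(subnSK ltKJ) addnS -addSn leq_add2r.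
have defjK : lspan_on (j |: K) = (tnth (in_tuple Ls) j + lspan_on K)%VS.
  by rewrite /lspan_on big_setU1.
rewrite (ltn_leqif (dimv_leqif_sup _)) defjK ?addvSr //.
apply/negP => /(subv_trans (addvSl _ _)) sjspan.
suff: J :\ j = J by move=> eqJ; move: Jj; rewrite -eqJ !inE eqxx.
apply: Jmin; last exact: subD1set.
have sKJj : K \subset J :\ j.
  by rewrite subsetD1 sKJ.
apply/andP; split.
  by apply: contraNneq K0 => eq0; rewrite -subset0 -eq0.
rewrite -spanJ eqEsubv; apply/andP; split; apply/subv_sumP => i.
  by rewrite in_setD1 => /andP[_ Ji]; apply: (sumv_sup i).
move=> Ji; have [->|neij] := eqVneq i j; last first.
  by apply: (sumv_sup i) => //; rewrite in_setD1 neij.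
apply: subv_trans sjspan _; apply/subv_sumP => l Kl.
by apply: (sumv_sup l) => //; apply: (subsetP sKJj).
Qed.

Lemma codimv_lcap_on_min r :
  (2 <= r)%N -> (forall U, U \in Ls -> codimv U <= r)%N ->
  (codimv (lcap_on J) <= r ^ 2)%N.
Proof.
move=> r2 codLs.
pose W j := tnth (in_tuple Ls) j.
have codW j : (\dim {:V} <= \dim (W j) + r)%N.
  by rewrite -codimv_le codLs ?mem_tnth.
have span1 j : lspan_on [set j] = W j by rewrite /lspan_on big_set1.
have leV U : (\dim U <= \dim {:V})%N by rewrite dimvS ?subvf.
have /minsetP[/andP[J0 _] _] := minJ.
have [j0 Jj0] := set0Pn _ J0.
(* Beyond [W j0] there are at most r dimensions, and each further index uses at least one. *)
have cardJ : (#|J| <= r.+1)%N.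
  have := @dim_lspan_on_min [set j0]; rewrite sub1set Jj0 span1 cards1.
  have -> : [set j0] != set0 by apply/set0Pn; exists j0; rewrite inE.
  move=> /(_ isT isT); have := codW j0; have := leV (lspan Ls); lia.
rewrite codimv_le -mulnn; have [leJr|ltrJ] := leqP #|J| r.
  have := @dimv_bigcap_lower _ J W fullv r; rewrite capfv => H.
  apply: leq_trans (H _) _ => [j _|]; first by rewrite capfv.
  by rewrite leq_add2l leq_mul2r leJr orbT.
have eqJ : #|J| = r.+1 by lia.
(* The other r - 1 indices use at least r - 1 dimensions beyond [W j0 + W j], which leaves at most
   one between [W j] and this sum. *)
have cap1 j : j \in J :\ j0 -> (\dim (W j0) <= \dim (W j0 :&: W j) + 1)%N.
  rewrite in_setD1 => /andP[neq Jj].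
  have := @dim_lspan_on_min [set j0; j].
  have -> : [set j0; j] != set0 by apply/set0Pn; exists j0; rewrite !inE eqxx.
  rewrite subUset !sub1set Jj0 Jj cards2 eq_sym neq eqJ => /(_ isT isT).
  have -> : lspan_on [set j0; j] = (W j0 + W j)%VS.
    by rewrite /lspan_on big_setU1 ?inE 1?eq_sym // big_set1.
  have := dimv_sum_cap (W j0) (W j); have := leV (lspan Ls).
  have := codW j; lia.
have := dimv_bigcap_lower cap1.
rewrite (cardsD1 j0) Jj0 in eqJ; rewrite (_ : #|_| = r); last by lia.
have -> : lcap_on J = (W j0 :&: \bigcap_(j in J :\ j0) W j)%VS.
  by rewrite /lcap_on (big_setD1 j0).
(* Codimension at most r for [W j0], plus r losses of at most 1, gives 2r <= r^2 because r >= 2. *)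
have := codW j0; nia.
Qed.

End MinimalFamily.

Lemma codimv_derivedn i Ls r :
  (2 <= r)%N -> (forall U, U \in Ls -> codimv U <= r)%N ->
  forall M, M \in derivedn i Ls -> (codimv M <= r ^ (2 ^ i))%N.
Proof.
move=> r2 codLs; elim: i => [|i IHi] M; first by rewrite expn0 expn1; exact: codLs.
move=> /derivedP[J minJ ->].
rewrite expnSr expnM; apply: (codimv_lcap_on_min minJ _ IHi).
by apply: (leq_trans r2); rewrite -{1}(expn1 r) leq_exp2l // expn_gt0.
Qed.

Lemma codimvS U W : (U <= W)%VS -> (codimv W <= codimv U)%N.
Proof. by move=> sUW; rewrite leq_sub2l ?dimvS. Qed.

End Codim.

(** * Comparing coefficients over an infinite domain *)

Section Infinite.

Variables (A : idomainType) (e : nat -> A) (n : nat).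
Hypothesis inj_e : injective e.
Implicit Types (g : {mpoly A[n]}) (x y : 'rV[A]_n).

Lemma hasse_eq0 b g x y :
  (forall a, g.@[(x + a *: y) 0] = 0) -> (hasse b y g).@[x 0] = 0.
Proof.
move=> g0; have: map_poly (meval (x 0)) (taylor y g) = 0.
  by apply: (poly_eq0_infinite inj_e) => a; rewrite horner_taylor.
by move/(congr1 (coefp b)); rewrite /= coef_map coef0.
Qed.

Lemma meval_scale d g a x :
  g \is d.-homog -> g.@[(a *: x) 0] = a ^+ d * g.@[x 0].
Proof.
move=> /dhomogP homg; rewrite !mevalE mulr_sumr.
rewrite !big_seq; apply: eq_bigr => m /homg <-.
rewrite mulrCA; congr (_ * _).
rewrite /= mdegE -prodrXr -big_split; apply: eq_bigr => i _.
by rewrite !mxE exprMn.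
Qed.

(** By homogeneity g(t y) = t^d g(y); compare the coefficients of t^d. *)
Lemma hasse_homog d g y :
  g \is d.-homog -> (hasse d y g).@[(0 : 'rV_n) 0] = g.@[y 0].
Proof.
move=> homg.
have: map_poly (meval ((0 : 'rV_n) 0)) (taylor y g) - g.@[y 0] *: 'X^d = 0.
  apply: (poly_eq0_infinite inj_e) => a; rewrite !hornerE horner_taylor.
  by rewrite add0r (meval_scale _ _ homg) mulrC subrr.
move/(congr1 (coefp d)); rewrite /= coefB coef_map coefZ coefXn eqxx mulr1 coef0.
by move/eqP; rewrite subr_eq0 => /eqP.
Qed.

End Infinite.

(** Supplies infinitely many scalars in a polynomial ring even when the base field is finite. *)
Lemma mpolyX_exp_inj (R : nzRingType) (q : nat) (i : 'I_q) :
  injective (fun j => 'X_i ^+ j : {mpoly R[q]}).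
Proof.
move=> j l /(congr1 (mcoeff (U_(i) *+ j))); rewrite !mcoeffXn eqxx.
case: eqP => [|_ /eqP]; last by rewrite oner_eq0.
by move=> /(congr1 (fun m : 'X_{1..q} => m i)); rewrite !mulmnE mnm1E eqxx !mul1n.
Qed.

(** * Vanishing on the span of a derived collection *)

Section Vanishing.

Variables (k : fieldType) (n q : nat).
Local Notation A := {mpoly k[q.+1]}.
Implicit Types (Ls : seq {vspace 'rV[k]_n}) (g : {mpoly A[n]}) (x y : 'rV[A]_n).

Lemma hasse_derivedn b Ls g M x y :
  (forall U, U \in Ls -> vanishes_on U g) ->
  M \in derivedn b.+1 Ls -> ext_in M x -> ext_in (lspan (derivedn b Ls)) y ->
  (hasse b.+1 y g).@[x 0] = 0.
Proof.
elim/ltn_ind: b => b IHb in Ls g M x y *; set S := lspan _ => g0 LsM Mx Sy.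
have /derivedP[J /minsetP[/andP[_ /eqP spanJ] _] defM] := LsM.
pose W j := tnth (in_tuple (derivedn b Ls)) j.
have [z Wz defy] : exists2 z, forall j, ext_in (W j) (z j) & y = \sum_(j in J) z j.
  by apply: ext_in_sum; rewrite -[X in ext_in X _]/(lspan_on J) spanJ.
(* Membership in [S] is carried along because the mixed terms need it for partial sums. *)
pose Q u := ext_in S u /\ (hasse b.+1 u g).@[x 0] = 0.
suff: Q y by case.
rewrite defy; apply: (big_ind Q).
- split; first exact: ext_in0.
  by rewrite hasse_at0 meval0.
- move=> u v [Su u0] [Sv v0]; split; first exact: ext_inD.
  rewrite hasseD raddf_sum /= big1 // => -[[|c] /= ltcb] _.
    by rewrite subn0 hasse0.
  rewrite ltnS ltnS in ltcb; rewrite subSS.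
  have [eqcb|neqcb] := eqVneq c b; first by rewrite eqcb subnn hasse0.
  have {neqcb}ltcb : (c < b)%N by rewrite ltn_neqAle neqcb.
  rewrite -[(b - c)%N](subnSK ltcb).
  have eqb : (b - c.+1 + c.+1)%N = b by rewrite subnK.
  (* A mixed term has order b - c <= b in [v]. The induction hypothesis at c shows that
     [hasse c.+1 u g] vanishes on the members of [derivedn c.+1 Ls]; it is then used again at b - c
     - 1. *)
  apply: (IHb _ _ (derivedn c.+1 Ls) _ M) => //.
  + by rewrite ltn_subrL (leq_ltn_trans _ ltcb).
  + move=> U LsU w Uw; apply: (IHb c ltcb Ls g U) => //.
    by apply: ext_inS Su; apply: lspan_derivedn_anti; exact: ltnW.
  + by rewrite -derivednD addSn eqb.
  + by rewrite -derivednD eqb.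
- move=> j Jj; split.
    by apply: ext_inS (Wz j); apply: sub_lspan; exact: mem_tnth.
  have [U LsU sWU] := derivedn_sub (mem_tnth j (in_tuple (derivedn b Ls))).
  apply: (hasse_eq0 (@mpolyX_exp_inj k q.+1 ord0)) => a; apply: (g0 U LsU).
  apply: (ext_inS sWU); apply: ext_inD; last exact: ext_inZ.
  by apply: ext_inS Mx; rewrite defM; apply: (bigcapv_inf j).
Qed.

Lemma homog_vanishes_on_lspan d Ls g :
  Ls != [::] -> g \is d.+1.-homog -> (forall U, U \in Ls -> vanishes_on U g) ->
  vanishes_on (lspan (derivedn d Ls)) g.
Proof.
move=> Ls0 homg g0 y Sy.
(* Any member will do, as the base point 0 lies in all of them, but one must exist. *)
have: derivedn d.+1 Ls != [::] by exact: derivedn_neq0.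
case defD: (derivedn d.+1 Ls) => [//|M D] _.
rewrite -(hasse_homog (@mpolyX_exp_inj k q.+1 ord0) y homg).
have LsM : M \in derivedn d.+1 Ls by rewrite defD mem_head.
exact: (hasse_derivedn g0 LsM (@ext_in0 _ _ _ M) Sy).
Qed.

End Vanishing.

(** Modulo the differences x_i - y_i the two evaluations agree. It will be applied to the generic
    point and its projection to a subspace. *)
Lemma meval_sub_ideal (n : nat) (R : comNzRingType) (g : {mpoly R[n]})
    (x y : 'I_n -> R) :
  exists h : 'I_n -> R, g.@[x] - g.@[y] = \sum_i h i * (x i - y i).
Proof.
pose P g := exists h : 'I_n -> R, g.@[x] - g.@[y] = \sum_i h i * (x i - y i).
have PC c : P c%:MP.
  by exists (fun=> 0); rewrite !mevalC subrr big1 // => i _; rewrite mul0r.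
have PX i : P 'X_i.
  exists (fun j => (j == i)%:R); rewrite !mevalXU (bigD1 i) //= eqxx mul1r.
  by rewrite big1 ?addr0 // => j /negbTE ->; rewrite mul0r.
have PD p r : P p -> P r -> P (p + r).
  move=> [hp Ep] [hr Er]; exists (fun i => hp i + hr i).
  rewrite !mevalD opprD addrACA Ep Er -big_split.
  by apply: eq_bigr => i _; rewrite mulrDl.
have PM p r : P p -> P r -> P (p * r).
  (* From p(x)r(x) - p(y)r(y) = r(x)(p(x) - p(y)) + p(y)(r(x) - r(y)). *)
  move=> [hp Ep] [hr Er]; exists (fun i => r.@[x] * hp i + p.@[y] * hr i).
  under eq_bigr do rewrite mulrDl -!mulrA.
  rewrite big_split /= -!mulr_sumr -Ep -Er !mevalM !mulrBr.
  by rewrite [p.@[x] * _]mulrC [r.@[x] * p.@[y]]mulrC addrA subrK.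
rewrite -/(P g); elim/mpolyind: g => [|c m p _ _].
  by rewrite -(mpolyC0 n R); exact: PC.
apply: PD; rewrite -mul_mpolyC; apply: (PM) => //.
rewrite mpolyXE_id; apply: (big_ind P) => // [|i _]; first exact: PC.
elim: (m i) => [|e IHe]; first by rewrite expr0; exact: PC.
by rewrite exprS; exact: PM.
Qed.

(** * From vanishing at a generic point back to the ideal *)

Section Generic.

Variables (k : fieldType) (n : nat).
Implicit Types (f : {mpoly k[n]}) (U : {vspace 'rV[k]_n}).
Local Notation A := {mpoly k[n]}.

Lemma mpoly_lift_generic f : (mpoly_lift n f).@[fun i => 'X_i] = f.
Proof.
rewrite [RHS]mpolyE [in LHS](mpolyE f) (raddf_sum (mpoly_lift n)).
rewrite (raddf_sum (meval _)); apply: eq_bigr => m _ /=.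
by rewrite /mpoly_lift map_mpolyZ map_mpolyX mevalZ mevalX mul_mpolyC -mpolyXE_id.
Qed.

(* Evaluate at the generic point of U, the projection Y of X = ('X_i)_i. *)
Lemma vanishes_on_contained U f :
  vanishes_on U (mpoly_lift n f) -> contained_in_hypersurface U f.
Proof.
move=> f0; pose X : 'rV[A]_n := \row_i 'X_i; pose Y := ext_lfun (projv U) X.
have UY : ext_in U Y by move=> m; rewrite coefv_ext_lfun memv_proj.
have [h defh] := meval_sub_ideal (mpoly_lift n f) (X 0) (Y 0).
rewrite (f0 Y UY) subr0 in defh.
(* These linear forms vanish on [U] because [projv U] fixes it. *)
exists n, h, (fun i => X 0 i - Y 0 i); split; last first.
  rewrite -defh -[LHS]mpoly_lift_generic; apply: meval_eq => i.
  by rewrite mxE.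
move=> i; rewrite /Y /ext_lfun !mxE.
under eq_bigr do rewrite !mxE mulrC mul_mpolyC.
split.
  apply: rpredB; first by rewrite dhomogX /= mdeg1.
  by apply: rpred_sum => j _; apply: rpredZ; rewrite dhomogX /= mdeg1.
move=> u Uu; rewrite mevalB mevalXU (raddf_sum (meval _)) /=.
under eq_bigr do rewrite mevalZ mevalXU mulrC.
have -> : \sum_j u 0 j * projv U 'e_j 0 i = u 0 i.
  rewrite -[in RHS](projv_id Uu) -mul_rV_lin1 mxE.
  by apply: eq_bigr => j _; rewrite mxE.
by rewrite subrr.
Qed.

End Generic.

Lemma mpoly_lift_homog (k : fieldType) (n q d : nat) (f : {mpoly k[n]}) :
  f \is d.-homog -> mpoly_lift q f \is d.-homog.
Proof.
move=> /dhomogP homf; apply/dhomogP => m.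
rewrite mcoeff_msupp mcoeff_map_mpoly /= mpolyC_eq0 -mcoeff_msupp.
exact: homf.
Qed.

Theorem theoremD (k : fieldType) (N d r : nat) (f : {mpoly k[N.+1]})
    (Ls : seq {vspace 'rV[k]_N.+1}) :
  (2 <= d)%N -> f != 0 -> f \is d.-homog ->
  (2 <= r)%N -> Ls != [::] ->
  (forall L, L \in Ls -> contained_in_hypersurface L f) ->
  (forall L, L \in Ls -> (codimv L <= r)%N) ->
  let L0 := lspan (derivedn d.-1 Ls) in
  contained_in_hypersurface L0 f /\ (codimv L0 <= r ^ (2 ^ d.-1))%N.
Proof.
move=> d2 _ homf r2 Ls0 LsX codLs L0; split.
  apply: vanishes_on_contained; apply: homog_vanishes_on_lspan => //.
    by apply: mpoly_lift_homog; rewrite prednK // ltnW.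
  by move=> U /LsX; exact: contained_vanishes_on.
(* A single member of the nonempty collection [derivedn d.-1 Ls] already bounds the codimension of
   the span. *)
rewrite {}/L0; have := codimv_derivedn r2 codLs (i := d.-1).
have := derivedn_neq0 d.-1 Ls0.
case: (derivedn d.-1 Ls) => // M D _ /(_ M (mem_head _ _)); apply: leq_trans.
by apply: codimvS; apply: sub_lspan; exact: mem_head.
Qed.
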